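(* Let $G$ be a finite simple graph with minimum degree $\delta(G)\ge 2$ such that either $g(G)=6$ or $g(G)\ge 8$. Then $G\notin\Omega$.
   Context: The girth $g(G)$ of a graph that is not a forest is the length of a shortest cycle; a forest has infinite girth. A star is a graph isomorphic to $K_{1,n}$ for some $n\ge 1$. A star-factor of $G$ is a spanning subgraph each of whose connected components is a star. An edge-weighting of $G$ is a function $w:E(G)\to\mathbb{N}^+$ (positive integers), and the weight of a subgraph $H$ is $w(H)=\sum_{e\in E(H)}w(e)$. $\Omega$ denotes the family of all graphs $G$ for which there exists an edge-weighting $w$ of $G$ such that all star-factors of $G$ have the same weight under $w$. *)

(* Defs.v *)
From mathcomp Require Import all_boot.

Set Implicit Arguments.
Unset Strict Implicit.
Unset Printing Implicit Defensive.

Record sgraph := SGraph {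
  vertex :> finType;
  adj : rel vertex;
  adj_sym : symmetric adj;
  adj_irr : irreflexive adj
}.

Definition edges (G : sgraph) : {set {set G}} :=
  [set [set p.1; p.2] | p : G * G & adj p.1 p.2].

Definition degree (G : sgraph) (x : G) : nat := #|[set y | adj x y]|.

(* Degrees are always smaller than #|G|, so #|G| is a neutral default value
   when G has a vertex; the graph without vertices gets minimum degree 0, hence
   is excluded by any positive lower bound on the minimum degree. *)
Definition min_degree (G : sgraph) : nat :=
  \big[minn/#|G|]_(x : G) degree x.

(* ucycleb alone also accepts [::] and the back-and-forth walk [:: x; y]. *)
Definition is_cycle (G : sgraph) (c : seq G) : bool :=
  (3 <= size c) && ucycleb (@adj G) c.

Definition has_cycle_of_length (G : sgraph) (n : nat) : bool :=
  [exists c : n.-tuple G, is_cycle c].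

(* None stands for infinity. The candidate lengths are listed in increasing
   order, and no cycle is longer than #|G|. *)
Definition girth (G : sgraph) : option nat :=
  ohead [seq n <- iota 0 #|G|.+1 | has_cycle_of_length G n].

Definition leq_inf (n : nat) (m : option nat) : bool :=
  if m is Some k then n <= k else true.

Definition isomorphic (G H : sgraph) : Prop :=
  exists f : G -> H, bijective f /\ forall x y, adj (f x) (f y) = adj x y.

(* The star K_{1,n}: None is the centre, the Some i are the n leaves. *)
Section Star.
Variable n : nat.

Definition star_rel : rel (option 'I_n) := fun x y => isSome x (+) isSome y.

Lemma star_rel_sym : symmetric star_rel.
Proof. by move=> x y; rewrite /star_rel addbC. Qed.

Lemma star_rel_irr : irreflexive star_rel.
Proof. by move=> x; rewrite /star_rel addbb. Qed.

Definition star : sgraph := SGraph star_rel_sym star_rel_irr.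
End Star.

Definition is_star (G : sgraph) : Prop :=
  exists n, 1 <= n /\ isomorphic G (star n).

Section Induced.
Variables (G : sgraph) (S : {set G}).

Definition induced_rel : rel {x : G | x \in S} :=
  fun x y => adj (val x) (val y).

Lemma induced_rel_sym : symmetric induced_rel.
Proof. by move=> x y; exact: adj_sym. Qed.

Lemma induced_rel_irr : irreflexive induced_rel.
Proof. by move=> x; exact: adj_irr. Qed.

Definition induced : sgraph := SGraph induced_rel_sym induced_rel_irr.
End Induced.

Definition component (G : sgraph) (x : G) : sgraph :=
  induced [set y | connect (@adj G) x y].

(* A spanning subgraph of G is given by its edge set F. The test x != y is
   redundant when F \subset edges G; it makes the definition total in F. *)
Section Spanning.
Variables (G : sgraph) (F : {set {set G}}).

Definition spanning_rel : rel G := fun x y => (x != y) && ([set x; y] \in F).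

Lemma spanning_rel_sym : symmetric spanning_rel.
Proof. by move=> x y; rewrite /spanning_rel eq_sym setUC. Qed.

Lemma spanning_rel_irr : irreflexive spanning_rel.
Proof. by move=> x; rewrite /spanning_rel eqxx. Qed.

Definition spanning : sgraph := SGraph spanning_rel_sym spanning_rel_irr.
End Spanning.

Definition star_factor (G : sgraph) (F : {set {set G}}) : Prop :=
  F \subset edges G /\ forall x : spanning F, is_star (component x).

(* Only the values of w on edges G are constrained or used. *)
Definition edge_weighting (G : sgraph) (w : {set G} -> nat) : Prop :=
  forall e, e \in edges G -> 0 < w e.

Definition weight (G : sgraph) (w : {set G} -> nat) (F : {set {set G}}) : nat :=
  \sum_(e in F) w e.

Definition Omega (G : sgraph) : Prop :=
  exists w : {set G} -> nat, edge_weighting w /\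
    forall F1 F2 : {set {set G}},
      star_factor F1 -> star_factor F2 -> weight w F1 = weight w F2.

(* Main.v *)
Require Import Defs.
From mathcomp Require Import all_boot zify.

Set Implicit Arguments.
Unset Strict Implicit.
Unset Printing Implicit Defensive.

(* Let v0 v1 ... be a shortest cycle. A vertex off this cycle has at most one
   neighbour on it, so deleting v0, ..., v5 isolates no vertex and what is left
   has a star-factor (if the cycle has length 6 or at least 8). It extends to
   G by the stars 01|23|45 and also by 012|345, so under a weighting as in Omega
   w(23) = w(12) + w(34). One step further along the cycle,
   w(34) = w(23) + w(45); adding up, w(12) + w(45) = 0, which is absurd. *)

(* A star-factor of the subgraph induced on S, given by the map sending each
   vertex to the centre of its star; in a star with two vertices either of
   them may be the centre. *)
Definition star_map (G : sgraph) (S : {set G}) (c : G -> G) : Prop :=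
  forall x, x \in S ->
    [/\ c x \in S, c (c x) = c x, c x != x -> adj x (c x)
      & exists2 y, y \in S & y != c x /\ c y = c x].

Definition star_edges (G : sgraph) (c : G -> G) : {set {set G}} :=
  [set [set x; c x] | x : G & c x != x].

Definition star_weight (G : sgraph) (w : {set G} -> nat) (S : {set G})
  (c : G -> G) : nat := \sum_(x in S | c x != x) w [set x; c x].

Definition no_isolated (G : sgraph) (S : {set G}) : Prop :=
  forall x, x \in S -> exists2 y, y \in S & adj x y.

Lemma set2_eq (T : finType) (x y a b : T) :
  [set x; y] = [set a; b] -> (x = a /\ y = b) \/ (x = b /\ y = a).
Proof.
move=> E.
have: x \in [set a; b] by rewrite -E set21.
have: y \in [set a; b] by rewrite -E set22.
have: a \in [set x; y] by rewrite E set21.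
have: b \in [set x; y] by rewrite E set22.
rewrite !inE => /orP[]/eqP hb /orP[]/eqP ha /orP[]/eqP hy /orP[]/eqP hx;
  subst; by [left | right].
Qed.

(** * Star-factors from centre maps *)

Section CentreMap.
Variables (G : sgraph) (c : G -> G).
Hypothesis cP : star_map setT c.

Let cK x : c (c x) = c x. Proof. by case: (cP (in_setT x)). Qed.

Lemma star_edges_adj (x y : G) :
  spanning_rel (star_edges c) x y = (x != y) && ((c x == y) || (c y == x)).
Proof.
rewrite /spanning_rel; case: eqVneq => //= nxy.
apply/imsetP/orP => [[z _ /set2_eq[[-> ->]|[-> ->]]]|].
- by left.
- by right.
case=> /eqP E.
- by exists x; rewrite ?E // inE E eq_sym.
- by exists y; rewrite ?E 1?setUC // inE E.
Qed.

(** Adjacent vertices share a centre because [c] is idempotent, and every vertex is joined to its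
    centre; so the components are the fibres of [c]. *)
Lemma star_edges_connect (x y : G) :
  connect (spanning_rel (star_edges c)) x y = (c x == c y).
Proof.
have sym := @spanning_rel_sym G (star_edges c).
have toc z : connect (spanning_rel (star_edges c)) z (c z).
  have [<-|nz] := eqVneq (c z) z; first by rewrite cK connect0.
  by apply: connect1; rewrite star_edges_adj eq_sym nz eqxx.
apply/idP/eqP => [/connectP[p]|E]; last first.
  apply: connect_trans (toc x) _.
  by rewrite E (sym_connect_sym sym).
elim: p x => [|z p IH] x /=; first by move=> _ ->.
rewrite star_edges_adj => /andP[/andP[_ h] hp] hy.
rewrite -(IH _ hp hy).
by case/orP: h => /eqP <-; rewrite cK.
Qed.

(** In the component of [x], the fibre of [c] over [c x], the centre goes to [None] and each leaf to
    its rank in [enum L]. *)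
Lemma star_factor_star_edges : star_factor (star_edges c).
Proof.
split.
  apply/subsetP=> e /imsetP[x]; rewrite inE => nx ->.
  apply/imsetP; exists (x, c x) => //.
  by rewrite inE; case: (cP (in_setT x)) => _ _ ->.
move=> x.
pose L : {set G} := [set y | (c y == c x) && (y != c x)].
exists #|L|; split.
  case: (cP (in_setT x)) => _ _ _ [y _ [nyx cy]].
  by apply/card_gt0P; exists y; rewrite inE cy eqxx.
(* A failing [insub] would also give [None], but the index of a leaf is below [#|L|], so only the
   centre is sent there. *)
pose f (y : component x) : star #|L| :=
  if val y == c x then None else insub (index (val y) (enum L)).
have cE (y : component x) : c (val y) = c x.
  by case: y => y /=; rewrite inE star_edges_connect => /eqP.
have memL (y : component x) : val y != c x -> val y \in L.
  by move=> ny; rewrite inE cE eqxx.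
have fP (y : component x) : val y != c x ->
    exists2 i, f y = Some i & val i = index (val y) (enum L).
  move=> ny; rewrite /f (negbTE ny).
  case: insubP => [i _ Ei|]; first by exists i.
  by rewrite cardE index_mem mem_enum memL.
have f0 (y : component x) : val y = c x -> f y = None.
  by move=> E; rewrite /f E eqxx.
exists f; split; last first.
  move=> y z; rewrite /= /star_rel.
  change (isSome (f y) (+) isSome (f z)
    = spanning_rel (star_edges c) (val y) (val z)).
  rewrite star_edges_adj !cE.
  have [Ey|ny] := eqVneq (val y) (c x); have [Ez|nz] := eqVneq (val z) (c x).
  - by rewrite !f0 // Ey Ez eqxx.
  - by have [i -> _] := fP z nz; rewrite f0 //= Ey eq_sym nz.
  - by have [i -> _] := fP y ny; rewrite f0 //= Ez ny.
  - have [i -> _] := fP y ny; have [j -> _] := fP z nz.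
    by rewrite andbF.
(* Injectivity is enough by counting: the component is [L] together with [c x]. *)
apply: inj_card_bij.
  move=> y z E; apply: val_inj.
  have [Ey|ny] := eqVneq (val y) (c x); have [Ez|nz] := eqVneq (val z) (c x).
  - by rewrite Ey.
  - by move: E; have [i -> _] := fP z nz; rewrite f0.
  - by move: E; have [i -> _] := fP y ny; rewrite f0.
  move: E; have [i -> Ei] := fP y ny; have [j -> Ej] := fP z nz.
  case=> Eij; move: Ei; rewrite Eij Ej => /(congr1 (nth (c x) (enum L))).
  by rewrite !nth_index ?mem_enum ?memL.
rewrite card_option card_ord card_sig.
have -> : #|[pred y | y \in
    [set y | connect (@adj (spanning (star_edges c))) x y]]| = #|c x |: L|.
  apply: eq_card => y; rewrite !inE star_edges_connect.
  by have [->|_] := eqVneq y (c x); rewrite ?cK ?orbT ?eqxx //= andbT eq_sym.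
by rewrite cardsU1 inE eqxx andbF.
Qed.

(** An edge determines its leaf: if two non-centres gave the same edge with its ends swapped, one of
    them would be a value of [c], hence fixed by [c]. *)
Lemma weight_star_edges (w : {set G} -> nat) :
  weight w (star_edges c) = star_weight w setT c.
Proof.
rewrite /weight /star_edges /star_weight big_imset /=.
  by apply: eq_bigl => x; rewrite !inE.
move=> x y; rewrite !inE => nx ny /set2_eq[[]//|[E1 E2]].
by move: nx; rewrite E1 cK -E1 eqxx.
Qed.

End CentreMap.

(** * Gluing centre maps, and the weights of small stars *)

Definition glue (G : sgraph) (S : {set G}) (c d : G -> G) : G -> G :=
  fun x => if x \in S then c x else d x.

Section Glue.
Variables (G : sgraph) (S T : {set G}) (c d : G -> G).
Hypothesis disjST : [disjoint S & T].

Let glueS x : x \in S -> glue S c d x = c x.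
Proof. by rewrite /glue => ->. Qed.

Let glueT x : x \in T -> glue S c d x = d x.
Proof. by move=> xT; rewrite /glue (disjointFl disjST xT). Qed.

Lemma star_map_glue :
  star_map S c -> star_map T d -> star_map (S :|: T) (glue S c d).
Proof.
move=> cP dP x; rewrite inE => /orP[xS|xT].
  case: (cP x xS) => cS cK ca [y yS [ny cy]].
  rewrite !glueS // inE cS; split=> //.
  by exists y; rewrite ?inE ?yS // glueS.
case: (dP x xT) => dT dK da [y yT [ny dy]].
rewrite !glueT // inE dT orbT; split=> //.
by exists y; rewrite ?inE ?yT ?orbT // glueT.
Qed.

Lemma star_weight_glue (w : {set G} -> nat) :
  star_weight w (S :|: T) (glue S c d) = star_weight w S c + star_weight w T d.
Proof.
rewrite /star_weight (bigID (mem S)) /=; congr (_ + _); apply: eq_big => x.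
- by rewrite inE; case: (boolP (x \in S)) => [xS|]; rewrite ?andbF ?glueS ?andbT.
- by case/andP=> _ xS; rewrite glueS.
- rewrite inE; case: (boolP (x \in T)) => [xT|].
    by rewrite (disjointFl disjST xT) glueT //= andbT.
  by case: (x \in S); rewrite ?andbF.
- rewrite inE => /andP[/andP[/orP[->//|xT] _] _]; by rewrite glueT.
Qed.

End Glue.

Lemma star_map_star (G : sgraph) (x y : G) (S : {set G}) :
  x \in S -> y \in S -> y != x -> (forall z, z \in S -> z != x -> adj z x) ->
  star_map S (fun _ => x).
Proof.
move=> xS yS nyx ha z zS.
by split=> //; [rewrite eq_sym; exact: ha | exists y].
Qed.

Lemma star_weight_edge (G : sgraph) (w : {set G} -> nat) (x y : G) :
  y != x -> star_weight w [set x; y] (fun _ => x) = w [set x; y].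
Proof.
move=> nyx; rewrite /star_weight (big_pred1 y); first by rewrite setUC.
move=> z; rewrite !inE /=; case: (eqVneq z x) => [->|nz] /=.
  by rewrite eq_sym (negbTE nyx).
by rewrite andbT.
Qed.

Lemma star_weight_cherry (G : sgraph) (w : {set G} -> nat) (x y z : G) :
  y != x -> z != x -> y != z ->
  star_weight w [set y; x; z] (fun _ => x) = w [set y; x] + w [set x; z].
Proof.
move=> nyx nzx nyz; rewrite /star_weight (bigD1 y) /=; last first.
  by rewrite !inE eqxx /= eq_sym.
congr (_ + _); rewrite (big_pred1 z); first by rewrite setUC.
move=> u; rewrite !inE /=; case: (eqVneq u y) => [->|nu] /=.
  by rewrite andbF (negbTE nyz).
case: (eqVneq u x) => [->|nux] /=; first by rewrite eq_sym (negbTE nzx).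
by rewrite !andbT.
Qed.

(** * Existence of star-factors when no vertex is isolated *)

Definition isolated_off (G : sgraph) (S D : {set G}) : {set G} :=
  [set z in S :\: D | [forall y in S :\: D, ~~ adj z y]].

(** A surviving [x] has a neighbour [y] in [S] outside [D]; then [y] has the neighbour [x], so it is
    not isolated and survives too. *)
Lemma no_isolated_off (G : sgraph) (S D : {set G}) :
  no_isolated (S :\: (D :|: isolated_off S D)).
Proof.
move=> x; rewrite !inE => /andP[]; rewrite negb_or => /andP[xD] /= ni xS.
move: ni; rewrite xD xS /= negb_forall_in => /exists_inP[y yS]; rewrite negbK => xy.
exists y => //; move: (yS); rewrite !inE => /andP[/negbTE -> ->] /=.
rewrite andbT; apply/negP => /forall_inP/(_ x).
by rewrite !inE xD xS adj_sym xy => /(_ isT).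
Qed.

(* If deleting some x isolates vertices, x and these form a star; otherwise
   deleting adjacent x, y isolates only common neighbours of x and y. *)
Lemma no_isolated_peel (G : sgraph) (S : {set G}) :
  S != set0 -> no_isolated S ->
  exists x : G, exists2 T : {set G}, (x \in T) && (T \subset S) &
    star_map T (fun _ => x) /\ no_isolated (S :\: T).
Proof.
move=> /set0Pn[x xS] niS.
have [/exists_inP[u uS /set0Pn[v vI]]|] :=
    boolP [exists u in S, isolated_off S [set u] != set0].
  (* The neighbour that [z] has in [S] can only be the deleted vertex [u]. *)
  have iso z : z \in isolated_off S [set u] -> (z != u) && adj z u.
    rewrite !inE => /andP[/andP[nzu zS] /forall_inP ha]; rewrite nzu /=.
    have [t tS zt] := niS z zS.
    have [<-//|ntu] := eqVneq t u.
    by have := ha t; rewrite !inE ntu tS zt => /(_ isT).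
  exists u, ([set u] :|: isolated_off S [set u]); last split.
  - rewrite !inE eqxx /= subUset sub1set uS; apply/subsetP=> z.
    by rewrite !inE => /andP[/andP[]].
  - have /andP[nvu _] := iso v vI.
    apply: (@star_map_star _ u v); rewrite ?in_setU ?vI ?orbT ?set11 //.
    move=> z; rewrite in_setU in_set1 => /orP[->//|/iso/andP[]//].
  - exact: no_isolated_off.
rewrite negb_exists_in => /forall_inP nI.
have [y yS xy] := niS x xS.
have nyx : y != x by apply: contraTneq xy => ->; rewrite adj_irr.
exists x, ([set x; y] :|: isolated_off S [set x; y]); last split.
- rewrite !inE eqxx /= subUset; apply/andP; split.
    by apply/subsetP=> z /set2P[]->.
  by apply/subsetP=> z; rewrite !inE => /andP[/andP[]].
- apply: (@star_map_star _ x y); rewrite ?in_setU ?in_set1 ?eqxx ?orbT //.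
  move=> z; rewrite in_setU => /orP[/set2P[->|->]|]; rewrite ?eqxx 1?adj_sym //.
  rewrite inE => /andP[zS /forall_inP ha] _.
  (* If [z] were not adjacent to [x], deleting [y] alone would already isolate it, against [nI]. *)
  apply: contraT => nxz.
  have := nI y yS; rewrite negbK => /eqP I0.
  suff: z \in isolated_off S [set y] by rewrite I0 inE.
  move: zS; rewrite !inE negb_or => /andP[/andP[nzx nzy] zS].
  rewrite nzy zS /=; apply/forall_inP=> t; rewrite !inE => /andP[nty tS].
  have [->|ntx] := eqVneq t x; first by rewrite adj_sym.
  by apply: ha; rewrite !inE negb_or ntx nty.
- exact: no_isolated_off.
Qed.

(** Strong induction on [#|S|]: peel off one star and glue it to a centre map of the remainder. *)
Lemma no_isolated_star_map (G : sgraph) (S : {set G}) :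
  no_isolated S -> exists c, star_map S c.
Proof.
have [n] := ubnP #|S|; elim: n S => // n IH S leSn niS.
have [->|nS0] := eqVneq S set0; first by exists id => x; rewrite inE.
have [x [T /andP[xT TS] [cT niD]]] := no_isolated_peel nS0 niS.
case: (IH _ _ niD) => [|d dP].
  apply: (leq_trans _ (leSn : #|S| <= n)); apply: proper_card.
  rewrite properEneq subsetDl andbT.
  by apply: contraTneq (subsetP TS x xT) => <-; rewrite inE xT.
exists (glue T (fun _ => x) d); rewrite -(setID S T) (setIidPr TS).
by apply: star_map_glue; rewrite // disjoint_sym disjoints_subset subsetDr.
Qed.

(** * Minimum degree, cycles and girth *)

Lemma degree_le_min_degree (G : sgraph) (x : G) : min_degree G <= degree x.
Proof.
rewrite /min_degree; have := mem_index_enum x.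
elim: (index_enum G) => // y s IH; rewrite inE big_cons geq_min.
by case/predU1P=> [->|/IH ->]; rewrite ?leqnn ?orbT.
Qed.

Lemma exists_adj_neq (G : sgraph) (x u : G) :
  2 <= min_degree G -> exists2 y, adj x y & y != u.
Proof.
move=> /leq_trans /(_ (degree_le_min_degree x)) /card_gt1P[a [b []]].
rewrite !inE => xa xb nab.
by have [E|nau] := eqVneq a u; [exists b; rewrite // -E eq_sym | exists a].
Qed.

(* Prepending neighbours other than the second vertex either closes a cycle or
   extends the path, and a path cannot outgrow G. *)
Lemma cycle_of_min_degree (G : sgraph) :
  2 <= min_degree G -> exists c : seq G, is_cycle c.
Proof.
move=> hd.
(* On the empty graph the minimum degree is the default [#|G|], that is 0. *)
have /card_gt0P[x0 _] : 0 < #|G|.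
  rewrite lt0n; apply: contraTneq hd => G0.
  by rewrite /min_degree big_pred0 ?G0 // => x; have := card0_eq G0 x.
have grow n : (exists c : seq G, is_cycle c) \/
    exists x, exists2 p, size p = n & path (@adj G) x p && uniq (x :: p).
  elim: n => [|n [?|[x [p sp /andP[xp up]]]]]; [right|by left|].
    by exists x0, [::].
  (* For a one-vertex path [head] returns the default [x], which is no neighbour of [x], so nothing
     is excluded. *)
  have [y xy nyu] := exists_adj_neq x (head x p) hd.
  have [|yp] := boolP (y \in x :: p); last first.
    right; exists y, (x :: p); first by rewrite /= sp.
    by rewrite cons_uniq yp up /= adj_sym xy xp.
  have nyx : y != x by apply: contraTneq xy => ->; rewrite adj_irr.
  rewrite inE (negbTE nyx) /= => yp; left.
  case/splitPr: yp => p1 p2 in xp up nyu sp *.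
  (* An empty [p1] would make [y] the second vertex, against its choice; hence the closed walk has
     at least three vertices. *)
  case: p1 => [|z p1] in xp up nyu sp *; first by rewrite /= eqxx in nyu.
  exists (x :: rcons (z :: p1) y).
  rewrite -cat_rcons cat_path in xp; rewrite -cat_rcons -cat_cons cat_uniq in up.
  case/andP: xp => xp _; case/andP: up => up _.
  rewrite /is_cycle /ucycleb up andbT [cycle _ _]rcons_path xp last_rcons.
  by rewrite adj_sym xy /= size_rcons.
case: (grow #|G|) => // -[x [p sp /andP[_ up]]].
by have := uniq_leq_size up (fun y _ => mem_enum G y); rewrite -cardE /= sp ltnn.
Qed.

(** Cycles have distinct vertices, so all their lengths are among the candidates; these increase, so
    the first one realised is the least. *)
Lemma girth_minimal (G : sgraph) (c : seq G) :
  is_cycle c -> exists2 d : seq G, is_cycle d &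
    girth G = Some (size d) /\ forall e : seq G, is_cycle e -> size d <= size e.
Proof.
have hasP (e : seq G) : is_cycle e ->
    size e \in [seq n <- iota 0 #|G|.+1 | has_cycle_of_length G n].
  move=> ce; rewrite mem_filter mem_iota add0n ltnS /=.
  have -> : size e <= #|G|.
    case/andP: ce => _ /andP[_ ue].
    by rewrite cardE; apply: uniq_leq_size => // y _; rewrite mem_enum.
  by rewrite andbT; apply/existsP; exists (in_tuple e).
have srt := sorted_filter ltn_trans (has_cycle_of_length G)
  (iota_ltn_sorted 0 #|G|.+1).
rewrite /girth; set L := filter _ _ in hasP srt *.
have LP n : n \in L -> has_cycle_of_length G n.
  by rewrite mem_filter => /andP[].
move=> /hasP; case: L srt LP hasP => // n L srt LP hasP _.
have /existsP[d cd] := LP n (mem_head _ _).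
exists (val d) => //; rewrite size_tuple; split=> // e /hasP.
rewrite inE => /predU1P[->//|/(allP (order_path_min ltn_trans srt)) /ltnW //].
Qed.

(** * Deleting an arc of a shortest cycle *)

Section ShortestCycle.
Variables (G : sgraph) (c : seq G).
Hypothesis cyc : is_cycle c.
Hypothesis cmin : forall d : seq G, is_cycle d -> size c <= size d.
Hypothesis cgt4 : 4 < size c.

(* Two neighbours of z split the cycle in two arcs, each of which closes up
   through z; the shorter one would give a cycle of length at most |c|/2 + 2. *)
Lemma shortest_cycle_adj (z a b : G) :
  z \notin c -> a \in c -> b \in c -> adj z a -> adj z b -> a = b.
Proof.
move=> zc ac bc za zb; apply/eqP/contraT => nab.
have [i q cE] := rot_to ac.
have bq : b \in q.
  by move: bc; rewrite -(mem_rot i) cE inE eq_sym (negbTE nab).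
have uq : uniq (z :: a :: q).
  by rewrite -cE cons_uniq mem_rot zc rot_uniq; case/andP: cyc => _ /andP[].
have cq : cycle (@adj G) (a :: q).
  by rewrite -cE rot_cycle; case/andP: cyc => _ /andP[].
have sz : size c = (size q).+1 by rewrite -(size_rot i) cE.
case/splitPr: bq => p1 p2 in uq cq sz.
rewrite /= rcons_cat cat_path /= in cq; case/and3P: cq => ap1 p1b bp2.
have c1 : is_cycle (z :: a :: rcons p1 b).
  move: uq; rewrite -cat_rcons -!cat_cons cat_uniq => /andP[u1 _].
  rewrite /is_cycle /ucycleb u1 andbT [cycle _ _]/= -rcons_cons rcons_path.
  by rewrite /= za rcons_path ap1 p1b last_rcons adj_sym zb size_rcons.
have c2 : is_cycle (z :: b :: rcons p2 a).
  have u2 : uniq (z :: b :: rcons p2 a).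
    move: uq; rewrite /= !inE !mem_cat !inE !rcons_uniq !mem_rcons !inE.
    rewrite cat_uniq /= !negb_or => /and5P[/and4P[-> _ -> ->]].
    by move=> /and3P[_ _ ->] _ _ /andP[-> ->]; rewrite eq_sym nab.
  rewrite /is_cycle /ucycleb u2 andbT [cycle _ _]/=.
  by rewrite zb rcons_path bp2 last_rcons adj_sym za /= size_rcons.
(* The two cycles have total length [size c + 4], so minimality would force [size c <= 4]. *)
have := leq_add (cmin c1) (cmin c2).
rewrite /= !size_rcons; move: cgt4; rewrite sz size_cat /=.
by clear; lia.
Qed.

(** A vertex off the cycle has two neighbours, at most one of them on the cycle, so one outside [p].
    A vertex of the remaining arc [s] has a neighbour along [s] unless it is alone there; when [p]
    has six vertices, that is the case of length 7. *)
Lemma shortest_cycle_rest (p s : seq G) :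
  2 <= min_degree G -> c = p ++ s -> size s != 1 -> no_isolated (~: [set:: p]).
Proof.
move=> hd cE s1 z; rewrite !inE => zp.
have [_ /andP[cycc]] := andP cyc; rewrite cE cat_uniq => /and3P[_ /hasPn ps us].
have out y : y \in s -> y \in ~: [set:: p] by rewrite !inE => /ps.
have [zs|zs] := boolP (z \in s); last first.
  have zc : z \notin c by rewrite cE mem_cat negb_or zp.
  have [a za _] := exists_adj_neq z z hd.
  have [ap|ap] := boolP (a \in p); last by exists a; rewrite ?inE.
  have [b zb nba] := exists_adj_neq z a hd.
  exists b; rewrite // !inE; apply: contra nba => bp; apply/eqP.
  by apply: (shortest_cycle_adj zc); rewrite // cE mem_cat ?ap ?bp.
have srt : sorted (@adj G) s.
  move: cycc; rewrite cE.
  case: (p) => [|x q] /=.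
    by case: (s) => //= x q; rewrite rcons_path => /andP[].
  by rewrite rcons_path cat_path => /andP[/andP[_ /path_sorted]].
case/splitPr: zs => s1' s2 in s1 srt out *.
(* The neighbour is the successor of [z] on the arc, or its predecessor if [z] comes last. *)
case: s2 => [|u s2] in s1 srt out *.
  case/lastP: s1' => [|s1' u] // in s1 srt out *.
  exists u; first by apply: out; rewrite mem_cat mem_rcons mem_head.
  by move: srt; rewrite -cats1 -catA => /cat_sorted2[_ /=]; rewrite adj_sym andbT.
exists u; first by apply: out; rewrite mem_cat !inE eqxx !orbT.
by case/cat_sorted2: srt => _ /= /andP[].
Qed.

End ShortestCycle.

(** * Weight identities along a cycle *)

Lemma is_cycle_rot (G : sgraph) (n : nat) (c : seq G) :
  is_cycle (rot n c) = is_cycle c.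
Proof. by rewrite /is_cycle /ucycleb size_rot rot_cycle rot_uniq. Qed.

Section UniformWeighting.
Variables (G : sgraph) (w : {set G} -> nat).
Hypothesis unif : forall F1 F2 : {set {set G}},
  star_factor F1 -> star_factor F2 -> weight w F1 = weight w F2.

(** Both maps extend to all of [G] by the same centre map off [T], whose contribution cancels. *)
Lemma star_weight_exchange (T : {set G}) (c d : G -> G) :
  no_isolated (~: T) -> star_map T c -> star_map T d ->
  star_weight w T c = star_weight w T d.
Proof.
move=> /no_isolated_star_map[e eP] cP dP.
have dis : [disjoint T & ~: T] by rewrite disjoints_subset setCK.
have fullP f : star_map T f -> star_map setT (glue T f e).
  by move=> fP; rewrite -(setUCr T); exact: star_map_glue.
have := unif (star_factor_star_edges (fullP c cP))
  (star_factor_star_edges (fullP d dP)).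
rewrite (weight_star_edges (fullP c cP)) (weight_star_edges (fullP d dP)).
by rewrite -(setUCr T) !star_weight_glue // => /addIn.
Qed.

(** Three single edges are exchanged for two paths of two edges; the end edges [v0 v1] and [v4 v5]
    occur on both sides and cancel. *)
Lemma six_path_weight (v0 v1 v2 v3 v4 v5 : G) :
  let p := [:: v0; v1; v2; v3; v4; v5] in
  uniq p -> sorted (@adj G) p -> no_isolated (~: [set:: p]) ->
  w [set v2; v3] = w [set v1; v2] + w [set v3; v4].
Proof.
move=> p up /and5P[a01 a12 a23 a34 /andP[a45 _]] rest.
move: up; rewrite /= !inE !negb_or -!andbA.
case/and5P=> n01 n02 n03 n04 /and5P[n05 n12 n13 n14].
case/and5P=> n15 n23 n24 n25 /and4P[n34 n35 n45 _].
have T3 : [set:: p] = [set v0; v1] :|: ([set v2; v3] :|: [set v4; v5]).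
  by apply/setP=> u; rewrite !inE -!orbA.
have T2 : [set:: p] = [set v0; v1; v2] :|: [set v3; v4; v5].
  by apply/setP=> u; rewrite !inE -!orbA.
have d45 : [disjoint [set v2; v3] & [set v4; v5]].
  rewrite disjoints_subset; apply/subsetP=> u.
  by rewrite !inE negb_or => /orP[]/eqP->; apply/andP.
have d23 : [disjoint [set v0; v1] & [set v2; v3] :|: [set v4; v5]].
  rewrite disjoints_subset; apply/subsetP=> u.
  by rewrite !inE !negb_or => /orP[]/eqP->; do ![apply/andP; split].
have d345 : [disjoint [set v0; v1; v2] & [set v3; v4; v5]].
  rewrite disjoints_subset; apply/subsetP=> u.
  by rewrite !inE !negb_or -orbA => /or3P[]/eqP->; do ![apply/andP; split].
have edgeP (x y : G) : adj x y -> x != y -> star_map [set x; y] (fun _ => x).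
  move=> xy nxy; apply: (@star_map_star _ x y); rewrite ?set21 ?set22 1?eq_sym //.
  by move=> z /set2P[]->; rewrite ?eqxx // adj_sym.
have cherryP (x y z : G) : adj x y -> adj y z -> x != y ->
    star_map [set x; y; z] (fun _ => y).
  move=> xy yz nxy; apply: (@star_map_star _ y x); rewrite ?inE ?eqxx ?orbT //.
  by move=> u; rewrite !inE -orbA => /or3P[]/eqP->; rewrite ?eqxx // adj_sym.
have := star_map_glue d23 (edgeP _ _ a01 n01)
  (star_map_glue d45 (edgeP _ _ a23 n23) (edgeP _ _ a45 n45)).
have := star_map_glue d345
  (cherryP _ _ _ a01 a12 n01) (cherryP _ _ _ a34 a45 n34).
rewrite -T3 -T2 => s2 s3; have := star_weight_exchange rest s2 s3.
rewrite {1}T2 T3 !star_weight_glue // !star_weight_edge 1?eq_sym //.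
by rewrite !star_weight_cherry // 1?eq_sym //; clear; lia.
Qed.

Lemma six_cycle_weight (v0 v1 v2 v3 v4 v5 : G) (s : seq G) :
  let c := [:: v0, v1, v2, v3, v4, v5 & s] in
  2 <= min_degree G -> is_cycle c ->
  (forall d : seq G, is_cycle d -> size c <= size d) -> size s != 1 ->
  w [set v2; v3] = w [set v1; v2] + w [set v3; v4].
Proof.
move=> c hd cyc cmin s1.
have cE : c = [:: v0; v1; v2; v3; v4; v5] ++ s by [].
apply: six_path_weight (shortest_cycle_rest cyc cmin isT hd cE s1).
  by case/andP: cyc => _ /andP[_]; rewrite cE cat_uniq => /andP[].
case/andP: cyc => _ /andP[]; rewrite cE /= => /and5P[-> -> -> ->].
by case/andP=> ->.
Qed.

End UniformWeighting.

Theorem theorem2p1 (G : sgraph) (hdelta : 2 <= min_degree G)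
  (hgirth : girth G = Some 6 \/ leq_inf 8 (girth G)) : ~ Omega G.
Proof.
case=> w [wpos unif].
(* A forest has girth [None], which satisfies [leq_inf 8]; the degree bound rules it out. *)
have [c0 cyc0] := cycle_of_min_degree hdelta.
have [c cyc [gE cmin]] := girth_minimal cyc0.
have sz : size c = 6 \/ 8 <= size c.
  by move: hgirth; rewrite gE => -[[->]|]; [left | right].
case: c => [|v0 [|v1 [|v2 [|v3 [|v4 [|v5 s]]]]]] in cyc gE cmin sz *;
  try by case: sz.
have s1 : size s != 1.
  by case: sz => /= [[E]|]; [rewrite E | case: (size s) => [|[]]].
have e1 := six_cycle_weight unif hdelta cyc cmin s1.
have : w [set v3; v4] = w [set v2; v3] + w [set v4; v5].
  have cycr : is_cycle (rot 1 [:: v0, v1, v2, v3, v4, v5 & s]).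
    by rewrite is_cycle_rot.
  have minr (d : seq G) : is_cycle d ->
      size (rot 1 [:: v0, v1, v2, v3, v4, v5 & s]) <= size d.
    by rewrite size_rot; exact: cmin.
  move: cycr minr; rewrite rot1_cons /=.
  (* After the rotation the sixth vertex is [v0] if the cycle has length 6 and [v6] otherwise; in
     the latter case the remaining arc ends with [v0] and keeps its size. *)
  case: s => [|v6 s] /= in cyc gE cmin sz s1 * => cycr minr.
    exact: (six_cycle_weight (s := [::]) unif hdelta cycr minr isT).
  have s1' : size (rcons s v0) != 1 by move: s1; rewrite size_rcons; case: sz.
  exact: (six_cycle_weight (s := rcons s v0) unif hdelta cycr minr s1').
have w12 : 0 < w [set v1; v2].
  apply: wpos; apply/imsetP; exists (v1, v2) => //; rewrite inE /=.
  by case/andP: cyc => _ /andP[/and3P[]].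
by move: e1 w12; clear; lia.
Qed.
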